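(* Let $L\ge2$, $k\ge2$ be integers, $\kappa:\{1,\dots,k-1\}\times\mathbb{N}\to\{0,\dots,L-1\}$ a map, $(a(n))_{n=0}^\infty$ an $(L,k,\kappa)$-TM sequence, and $\beta>1$ an integer. Suppose all $a(n)\in\{0,1,\dots,\beta-1\}$ and the TM sequence is $n$-period. Then for all integers $N\ge0$, $l>0$, the irrationality exponent $\mu\big(\sum_{n=0}^\infty\frac{a(N+nl)}{\beta^{n+1}}\big)$ is finite, unless there exists an integer $A\ge0$ with $$\kappa(s,A+y)\equiv\kappa(1,A)\,s\,k^y\pmod L\quad\text{for all }1\le s\le k-1,\ y\in\mathbb{N}.$$
   Context: $\mathbb{N}$ is the set of non-negative integers. Let $a_0,\dots,a_{L-1}$ be pairwise distinct complex numbers and $f$ the map on $\{a_0,\dots,a_{L-1}\}$ with $f(a_i)=a_{i+1}$ (indices mod $L$), extended letterwise to words, with iterates $f^j$, $f^0=\mathrm{id}$. Define $A_0=a_0$, $A_{n+1}=A_n\,f^{\kappa(1,n)}(A_n)\cdots f^{\kappa(k-1,n)}(A_n)$ (concatenation); the limit infinite word, indexed from $0$, is the $(L,k,\kappa)$-TM sequence. It is called $n$-period if there exist integers $N_0\ge0$, $t>0$ with $\kappa(s,n)=\kappa(s,n+t)$ for all $1\le s\le k-1$, $n\ge N_0$. For an irrational real $\alpha$, the irrationality exponent $\mu(\alpha)$ is the supremum of real $\mu$ such that $|\alpha-p/q|<q^{-\mu}$ has infinitely many solutions in nonzero integers $p,q$. *)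

(* Defs.v *)
From Stdlib Require Import Reals List Arith.
From Coquelicot Require Import Coquelicot.
Import ListNotations.
Open Scope R_scope.

(* Letters a_0,...,a_{L-1} are represented by their indices 0..L-1; the map
   f(a_i) = a_{i+1 mod L} acts on indices as i |-> (i+1) mod L, so
   f^j acts as i |-> (i+j) mod L. *)
Definition shift_word (L j : nat) (w : list nat) : list nat :=
  map (fun i => ((i + j) mod L)%nat) w.

Fixpoint TM_word (L k : nat) (kappa : nat -> nat -> nat) (n : nat) : list nat :=
  match n with
  | O => [0%nat]
  | S m => TM_word L k kappa m ++
           concat (map (fun s => shift_word L (kappa s m) (TM_word L k kappa m))
                       (seq 1 (k - 1)))
  end.

(* The limit infinite word (as indices), indexed from 0: A_n is a prefix of
   A_{n+1} and |A_{n+1}| = k^{n+1} > n for k >= 2. *)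
Definition TM_index (L k : nat) (kappa : nat -> nat -> nat) (i : nat) : nat :=
  nth i (TM_word L k kappa (S i)) 0%nat.

Definition TM_seq (L k : nat) (kappa : nat -> nat -> nat) (av : nat -> C)
  (i : nat) : C := av (TM_index L k kappa i).

Definition n_period (k : nat) (kappa : nat -> nat -> nat) : Prop :=
  exists N0 t : nat, (0 < t)%nat /\
    forall s n, (1 <= s <= k - 1)%nat -> (N0 <= n)%nat -> kappa s n = kappa s (n + t)%nat.

Definition is_rational (x : R) : Prop :=
  exists p q : Z, q <> 0%Z /\ x = IZR p / IZR q.

Definition approx_sol (x mu : R) (p q : Z) : Prop :=
  p <> 0%Z /\ q <> 0%Z /\
  Rabs (x - IZR p / IZR q) < Rpower (Rabs (IZR q)) (- mu).

Definition infinitely_many_sols (x mu : R) : Prop :=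
  forall l : list (Z * Z), exists p q, approx_sol x mu p q /\ ~ In (p, q) l.

Definition irr_exponent_finite (x : R) : Prop :=
  ~ is_rational x /\
  exists M : R, forall mu : R, infinitely_many_sols x mu -> mu <= M.

(* Main.v *)
Require Import Defs.
From Stdlib Require Import Reals List Arith Lia Lra ZArith Classical IndefiniteDescription.
From Coquelicot Require Import Coquelicot.
Open Scope R_scope.

(* Writing sigma_A(i) for the sum of kappa(d_n, A+n) over the base-k digits d_n
   of i, the letter of index i is sigma_0(i) mod L. By periodicity there are
   lengths M_m = k^(N0+tm) with sigma_0(c M_m + r) = sigma_0(r) + S(c) for
   r < M_m, where S = sigma_N0 does not depend on m. A fixed D > 0 satisfies
   S(c + D l) = S(c) mod L for c <= l, so the subsequence b(n) = a(N + n l) has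
   b(n + D M_m) = b(n) for n < M_m; this gives rational approximants with
   denominator Q = beta^(D M_m) - 1 and error at most 1 / (Q beta^(M_m)).
   If S had period D l, a carry argument would make some sigma_A linear mod L,
   which is the excluded case. Otherwise the approximants of index m and m + h
   differ for a fixed h, so every p/q differs from one of two approximants of
   suitable size, and |xi - p/q| >= c q^(-E). *)

(** * Congruence mod [L] and base-[k] digit sums with level-dependent weights *)

Definition congr (L x y : nat) : Prop :=
  (Z.of_nat L | Z.of_nat x - Z.of_nat y)%Z.

Lemma congr_mod_eq (L x y : nat) :
  (0 < L)%nat -> (congr L x y <-> (x mod L = y mod L)%nat).
Proof.
intros HL. unfold congr. split.
- intros [z Hz].
  apply Nat2Z.inj. rewrite !Nat2Z.inj_mod.
  replace (Z.of_nat x) with (Z.of_nat y + z * Z.of_nat L)%Z by lia.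
  apply Z.mod_add. lia.
- intros H.
  exists (Z.of_nat (x / L) - Z.of_nat (y / L))%Z.
  pose proof (Nat.div_mod_eq x L). pose proof (Nat.div_mod_eq y L). nia.
Qed.

(** Digit 0 has weight 0 because block 0 of [A_{n+1}] is [A_n] itself, unshifted. *)
Definition digit_weight (kappa : nat -> nat -> nat) (A d : nat) : nat :=
  if (d =? 0)%nat then 0%nat else kappa d A.

(** [A] is the level of the lowest digit and rises by one with each division by [k]. *)
Fixpoint digit_sum_fuel (k : nat) (kappa : nat -> nat -> nat) (fuel A i : nat)
  : nat :=
  match fuel with
  | O => 0%nat
  | S f => (digit_weight kappa A (i mod k)
            + digit_sum_fuel k kappa f (S A) (i / k))%nat
  end.

(* [i] itself is enough fuel, since [i < k ^ i] for [k >= 2]. *)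
Definition digit_sum (k : nat) (kappa : nat -> nat -> nat) (A i : nat) : nat :=
  digit_sum_fuel k kappa i A i.

Lemma digit_sum_fuel_0 (k : nat) (kappa : nat -> nat -> nat) (f A : nat) :
  (2 <= k)%nat -> digit_sum_fuel k kappa f A 0 = 0%nat.
Proof.
intros Hk. revert A. induction f as [|f IH]; intros A; simpl; auto.
rewrite Nat.Div0.mod_0_l, Nat.Div0.div_0_l, IH. reflexivity.
Qed.

Lemma digit_sum_fuel_indep (k : nat) (kappa : nat -> nat -> nat)
  (f f' A i : nat) :
  (2 <= k)%nat -> (i < k ^ f)%nat -> (i < k ^ f')%nat ->
  digit_sum_fuel k kappa f A i = digit_sum_fuel k kappa f' A i.
Proof.
intros Hk. revert f' A i. induction f as [|f IH]; intros f' A i H H'.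
- simpl in H. replace i with 0%nat by lia.
  rewrite !digit_sum_fuel_0; auto.
- destruct f' as [|f'].
  + simpl in H'. replace i with 0%nat by lia.
    rewrite !digit_sum_fuel_0; auto.
  + simpl. f_equal. apply IH; apply Nat.Div0.div_lt_upper_bound; simpl in *; lia.
Qed.

Lemma digit_sum_0 (k : nat) (kappa : nat -> nat -> nat) (A : nat) :
  digit_sum k kappa A 0 = 0%nat.
Proof. reflexivity. Qed.

Lemma digit_sum_step (k : nat) (kappa : nat -> nat -> nat) (A i : nat) :
  (2 <= k)%nat ->
  digit_sum k kappa A i
  = (digit_weight kappa A (i mod k) + digit_sum k kappa (S A) (i / k))%nat.
Proof.
intros Hk. unfold digit_sum at 1.
pose proof (Nat.pow_gt_lin_r k i Hk).
(* One more unit of fuel exposes a recursive call even when [i] is 0. *)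
rewrite (digit_sum_fuel_indep k kappa i (S i)); auto; [|simpl; nia].
simpl. f_equal. unfold digit_sum. apply digit_sum_fuel_indep; auto.
- apply Nat.Div0.div_lt_upper_bound. nia.
- apply Nat.pow_gt_lin_r. lia.
Qed.

Lemma digit_sum_small (k : nat) (kappa : nat -> nat -> nat) (A s : nat) :
  (2 <= k)%nat -> (s < k)%nat -> digit_sum k kappa A s = digit_weight kappa A s.
Proof.
intros Hk Hs. rewrite digit_sum_step; auto.
rewrite Nat.mod_small, Nat.div_small, digit_sum_0 by auto. lia.
Qed.

(** The digits of [j * k^n + r] are those of [r], padded to length [n], followed by those of [j],
    which therefore start at level [A + n]. *)
Lemma digit_sum_split (k : nat) (kappa : nat -> nat -> nat) (n A j r : nat) :
  (2 <= k)%nat -> (r < k ^ n)%nat ->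
  digit_sum k kappa A (j * k ^ n + r)
  = (digit_sum k kappa A r + digit_sum k kappa (A + n) j)%nat.
Proof.
intros Hk. revert A r. induction n as [|n IH]; intros A r Hr.
- simpl in *. replace r with 0%nat by lia.
  rewrite digit_sum_0, !Nat.add_0_r, Nat.mul_1_r. reflexivity.
- rewrite (digit_sum_step k kappa A (j * k ^ S n + r)); auto.
  rewrite (digit_sum_step k kappa A r); auto.
  replace (j * k ^ S n + r)%nat with (r + (j * k ^ n) * k)%nat by (simpl; ring).
  rewrite Nat.Div0.mod_add, Nat.div_add by lia.
  rewrite (Nat.add_comm (r / k)), IH.
  + rewrite <- (Nat.add_succ_comm A n). lia.
  + apply Nat.Div0.div_lt_upper_bound. simpl in Hr. lia.
Qed.

Lemma digit_sum_period (k : nat) (kappa : nat -> nat -> nat) (N0 t m A i : nat) :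
  (2 <= k)%nat ->
  (forall s n, (1 <= s <= k - 1)%nat -> (N0 <= n)%nat ->
     kappa s n = kappa s (n + t)%nat) ->
  (N0 <= A)%nat ->
  digit_sum k kappa (A + t * m) i = digit_sum k kappa A i.
Proof.
intros Hk Hper. unfold digit_sum. generalize i at 1 3 as f.
assert (Hone : forall f A i, (N0 <= A)%nat ->
   digit_sum_fuel k kappa f (A + t) i = digit_sum_fuel k kappa f A i).
{ intros f. induction f as [|f IH]; intros A' i' HA; simpl; auto.
  rewrite <- (IH (S A')) by lia. simpl. f_equal.
  unfold digit_weight.
  pose proof (Nat.mod_upper_bound i' k).
  destruct (Nat.eqb_spec (i' mod k) 0); auto.
  symmetry; apply Hper; lia. }
intros f HA. induction m as [|m IH].
- rewrite Nat.mul_0_r, Nat.add_0_r. reflexivity.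
- replace (A + t * S m)%nat with (A + t * m + t)%nat by ring.
  rewrite Hone by lia. exact IH.
Qed.

(** * Letters of the TM words as digit sums mod [L] *)

Lemma nth_concat_blocks (g : nat -> list nat) (B c a s r : nat) :
  (forall x, length (g x) = B) -> (s < c)%nat -> (r < B)%nat ->
  nth (s * B + r) (concat (map g (seq a c))) 0%nat = nth r (g (a + s)%nat) 0%nat.
Proof.
intros Hg. revert a s. induction c as [|c IH]; intros a s Hs Hr; [lia|].
simpl. destruct s as [|s].
- rewrite Nat.add_0_r. apply app_nth1. rewrite Hg. exact Hr.
- rewrite app_nth2; rewrite Hg; [|simpl; lia].
  replace (S s * B + r - B)%nat with (s * B + r)%nat by (simpl; lia).
  rewrite IH by lia. f_equal. f_equal. lia.
Qed.

Lemma length_concat_blocks (g : nat -> list nat) (B c a : nat) :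
  (forall x, length (g x) = B) ->
  length (concat (map g (seq a c))) = (c * B)%nat.
Proof.
intros Hg. revert a. induction c as [|c IH]; intros a; simpl; auto.
rewrite length_app, Hg, IH. reflexivity.
Qed.

Lemma TM_word_length (L k : nat) (kappa : nat -> nat -> nat) (n : nat) :
  (2 <= k)%nat -> length (TM_word L k kappa n) = (k ^ n)%nat.
Proof.
intros Hk. induction n as [|n IH]; [reflexivity|].
simpl. rewrite length_app, IH, (length_concat_blocks _ (k ^ n)).
- nia.
- intros x. unfold shift_word. rewrite length_map. exact IH.
Qed.

(** Index [s * k^n + r] lies in block [s], a copy of [A_n] shifted by [kappa s n] when [s > 0]: the
    top digit contributes exactly its weight. *)
Lemma TM_word_nth (L k : nat) (kappa : nat -> nat -> nat) (n i : nat) :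
  (0 < L)%nat -> (2 <= k)%nat -> (i < k ^ n)%nat ->
  nth i (TM_word L k kappa n) 0%nat = (digit_sum k kappa 0 i mod L)%nat.
Proof.
intros HL Hk. revert i. induction n as [|n IH]; intros i Hi.
- simpl in Hi. replace i with 0%nat by lia.
  rewrite digit_sum_0, Nat.Div0.mod_0_l. reflexivity.
- simpl.
  assert (HB : (k ^ n <> 0)%nat) by (apply Nat.pow_nonzero; lia).
  pose proof (Nat.div_mod_eq i (k ^ n)) as Hdm.
  pose proof (Nat.mod_upper_bound i (k ^ n) HB) as Hr.
  assert (Hs : (i / k ^ n < k)%nat)
    by (apply Nat.Div0.div_lt_upper_bound; simpl in Hi; lia).
  set (s := (i / k ^ n)%nat) in *. set (r := (i mod k ^ n)%nat) in *.
  rewrite Hdm, (Nat.mul_comm (k ^ n)).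
  rewrite digit_sum_split, (digit_sum_small k kappa (0 + n)) by auto.
  unfold digit_weight.
  destruct (Nat.eqb_spec s 0) as [H0|H0].
  + rewrite H0, app_nth1; [|rewrite TM_word_length; simpl; lia].
    simpl. rewrite Nat.add_0_r. apply IH; auto.
  + rewrite app_nth2; rewrite TM_word_length by lia; [|nia].
    (* Block 0 stands outside the [concat], so block [s] is number [s - 1] there. *)
    replace (s * k ^ n + r - k ^ n)%nat with ((s - 1) * k ^ n + r)%nat by nia.
    rewrite (nth_concat_blocks _ (k ^ n)); try lia.
    * replace (1 + (s - 1))%nat with s by lia.
      unfold shift_word.
      (* [map_nth] needs a default that is itself an image, here that of 0. *)
      rewrite (nth_indep _ 0%nat ((0 + kappa s n) mod L)%nat).
      2: { rewrite length_map, TM_word_length; lia. }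
      rewrite (map_nth (fun i => ((i + kappa s n) mod L)%nat)).
      rewrite IH by auto. apply Nat.Div0.add_mod_idemp_l.
    * intros x. unfold shift_word. rewrite length_map. apply TM_word_length; auto.
Qed.

Lemma TM_index_digit_sum (L k : nat) (kappa : nat -> nat -> nat) (i : nat) :
  (0 < L)%nat -> (2 <= k)%nat ->
  TM_index L k kappa i = (digit_sum k kappa 0 i mod L)%nat.
Proof.
intros HL Hk. unfold TM_index. apply TM_word_nth; auto.
pose proof (Nat.pow_gt_lin_r k (S i)). lia.
Qed.

(** * Periods and returns of digit sums mod [L] *)

(* Adding the period to [w k^m + (k^m - 1)] produces a carry into [w], so the
   increment of the digit sum of [w] does not depend on [w]. *)
Lemma digit_sum_periodic_linear (L k : nat) (kappa : nat -> nat -> nat)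
  (A p : nat) :
  (2 <= k)%nat -> (0 < p)%nat ->
  (forall v, congr L (digit_sum k kappa A v) (digit_sum k kappa A (v + p))) ->
  forall w, congr L (digit_sum k kappa (A + p) w)
                    (w * digit_sum k kappa (A + p) 1).
Proof.
intros Hk Hp Hper.
pose proof (Nat.pow_gt_lin_r k p Hk) as HM.
assert (Hstep : forall w, congr L
  (digit_sum k kappa (A + p) w + digit_sum k kappa A (k ^ p - 1))
  (digit_sum k kappa (A + p) (S w) + digit_sum k kappa A (p - 1))).
{ intros w. specialize (Hper (w * k ^ p + (k ^ p - 1))%nat).
  replace (w * k ^ p + (k ^ p - 1) + p)%nat
    with (S w * k ^ p + (p - 1))%nat in Hper by (simpl; lia).
  rewrite !digit_sum_split in Hper by lia.
  rewrite (Nat.add_comm (digit_sum k kappa (A + p) w)).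
  rewrite (Nat.add_comm (digit_sum k kappa (A + p) (S w))). exact Hper. }
induction w as [|w IH].
- rewrite digit_sum_0. exists 0%Z. lia.
- destruct IH as [z Hz], (Hstep 0%nat) as [z0 Hz0], (Hstep w) as [z1 Hz1].
  rewrite digit_sum_0 in Hz0.
  (* Comparing the step at [w] with the step at 0 cancels both constants and leaves an increment
     congruent to [digit_sum k kappa (A + p) 1]. *)
  exists (z + z0 - z1)%Z. nia.
Qed.

(* [x] is a repunit in base [k ^ a], so [x * l] repeats the digits of [l]
   exactly [L] times and its digit sum vanishes mod [L]. *)
Lemma digit_sum_return (L k : nat) (kappa : nat -> nat -> nat) (N0 t l : nat) :
  (0 < L)%nat -> (2 <= k)%nat -> (0 < t)%nat ->
  (forall s n, (1 <= s <= k - 1)%nat -> (N0 <= n)%nat ->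
     kappa s n = kappa s (n + t)%nat) ->
  exists D, (0 < D)%nat /\ forall c, (c <= l)%nat ->
    congr L (digit_sum k kappa N0 (c + D * l)) (digit_sum k kappa N0 c).
Proof.
intros HL Hk Ht Hper.
(* [K > l] keeps the copies of [l] disjoint; the exponent is a multiple of [t], so every copy is
   weighted as at level [N0]. *)
set (K := (k ^ (t * l))%nat).
assert (HlK : (l < K)%nat).
{ unfold K. pose proof (Nat.pow_gt_lin_r k (t * l) Hk). nia. }
assert (Hsplit : forall j r, (r < K)%nat ->
  digit_sum k kappa N0 (j * K + r)
  = (digit_sum k kappa N0 r + digit_sum k kappa N0 j)%nat).
{ intros j r Hr. unfold K in *. rewrite digit_sum_split by auto.
  rewrite (digit_sum_period k kappa N0 t) by auto. reflexivity. }
(* The bound [q <= x] serves to make the final witness positive. *)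
assert (Hx : forall q, exists x, (q <= x)%nat /\
  digit_sum k kappa N0 (x * l) = (q * digit_sum k kappa N0 l)%nat).
{ induction q as [|q [x [Hqx Hx]]].
  - exists 0%nat. split; [lia|]. rewrite Nat.mul_0_l, digit_sum_0. lia.
  - exists (x * K + 1)%nat. split; [nia|].
    replace ((x * K + 1) * l)%nat with (x * l * K + l)%nat by ring.
    rewrite Hsplit, Hx by auto. ring. }
destruct (Hx L) as [x [HLx Hxl]].
(* The factor [K] lifts [x * l] above the digits of [c <= l < K], so no carry occurs. *)
exists (x * K)%nat. split; [nia|].
intros c Hc.
replace (c + x * K * l)%nat with (x * l * K + c)%nat by ring.
rewrite Hsplit, Hxl by lia.
exists (Z.of_nat (digit_sum k kappa N0 l)). nia.
Qed.

(** * Real numbers given by base-[beta] digit sequences *)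

Definition val (beta : nat) (u : nat -> nat) : R :=
  Series (fun n => INR (u n) / INR beta ^ (n + 1)).

Definition shift_seq (n : nat) (u : nat -> nat) : nat -> nat := fun i => u (n + i)%nat.

Lemma shift_seq_0 (n : nat) (u : nat -> nat) : shift_seq n u 0%nat = u n.
Proof. unfold shift_seq. rewrite Nat.add_0_r. reflexivity. Qed.

(** The integer with digits [u 0], ..., [u (n - 1)], most significant first. *)
Fixpoint prefix_int (beta : nat) (u : nat -> nat) (n : nat) : nat :=
  match n with
  | O => 0%nat
  | S m => (beta * prefix_int beta u m + u m)%nat
  end.

(** Dominating series for all digit sequences: the expansion of 1 with every digit [beta - 1]. *)
Lemma is_series_max_digits (beta : nat) :
  (1 < beta)%nat ->
  is_series (fun n => (INR beta - 1) / INR beta ^ (n + 1)) 1.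
Proof.
intros Hb. assert (Hb' : 1 < INR beta) by (apply (lt_INR 1); auto).
assert (Hq : Rabs (/ INR beta) < 1).
{ rewrite Rabs_pos_eq; [|left; apply Rinv_0_lt_compat; lra].
  rewrite <- Rinv_1. apply Rinv_lt_contravar; lra. }
pose proof (is_series_scal ((INR beta - 1) / INR beta) _ _
              (is_series_geom (/ INR beta) Hq)) as H.
replace 1 with (scal ((INR beta - 1) / INR beta) (/ (1 - / INR beta))).
- eapply is_series_ext; [|exact H].
  intros n. unfold scal; simpl; unfold mult; simpl.
  rewrite pow_add, pow_inv, pow_1. assert (INR beta ^ n <> 0) by (apply pow_nonzero; lra). field. repeat split; lra.
- unfold scal; simpl; unfold mult; simpl. field. lra.
Qed.

Lemma val_term_bounds (beta : nat) (u : nat -> nat) (n : nat) :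
  (1 < beta)%nat -> (u n < beta)%nat ->
  0 <= INR (u n) / INR beta ^ (n + 1) <= (INR beta - 1) / INR beta ^ (n + 1).
Proof.
intros Hb Hu. assert (Hb' : 1 < INR beta) by (apply (lt_INR 1); auto).
assert (Hp : 0 < INR beta ^ (n + 1)) by (apply pow_lt; lra).
pose proof (pos_INR (u n)).
assert (INR (u n) <= INR beta - 1).
{ apply le_INR in Hu. rewrite S_INR in Hu. lra. }
split.
- apply Rmult_le_pos; auto. left; apply Rinv_0_lt_compat; auto.
- apply Rmult_le_compat_r; auto. left; apply Rinv_0_lt_compat; auto.
Qed.

Lemma ex_series_val (beta : nat) (u : nat -> nat) :
  (1 < beta)%nat -> (forall n, (u n < beta)%nat) ->
  ex_series (fun n => INR (u n) / INR beta ^ (n + 1)).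
Proof.
intros Hb Hu.
apply (ex_series_le (K := R_AbsRing) (V := R_CompleteNormedModule) _
         (fun n => (INR beta - 1) / INR beta ^ (n + 1))).
- intros n. unfold norm; simpl; unfold abs; simpl.
  rewrite Rabs_pos_eq; apply val_term_bounds; auto.
- exists 1. apply is_series_max_digits; auto.
Qed.

Lemma val_bounds (beta : nat) (u : nat -> nat) :
  (1 < beta)%nat -> (forall n, (u n < beta)%nat) -> 0 <= val beta u <= 1.
Proof.
intros Hb Hu. pose proof (is_series_max_digits beta Hb) as Hm.
split.
- unfold val. replace 0 with (Series (fun _ : nat => 0 * 0)) by (rewrite Series_scal_l; ring).
  apply Series_le; [|apply ex_series_val; auto].
  intros n; rewrite Rmult_0_l; split; [lra|]. apply val_term_bounds; auto.
- rewrite <- (is_series_unique _ _ Hm). apply Series_le.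
  + intros n. apply val_term_bounds; auto.
  + exists 1; auto.
Qed.

Lemma val_ext (beta : nat) (u v : nat -> nat) :
  (forall n, u n = v n) -> val beta u = val beta v.
Proof. intros H. apply Series_ext. intros n. rewrite H. reflexivity. Qed.

Lemma val_step (beta : nat) (u : nat -> nat) :
  (1 < beta)%nat -> (forall n, (u n < beta)%nat) ->
  val beta u = (INR (u 0%nat) + val beta (shift_seq 1 u)) / INR beta.
Proof.
intros Hb Hu. assert (Hb' : 1 < INR beta) by (apply (lt_INR 1); auto).
unfold val at 1. rewrite Series_incr_1 by (apply ex_series_val; auto).
rewrite Rdiv_plus_distr. f_equal.
- simpl. f_equal. ring.
- unfold val, Rdiv. rewrite Rmult_comm, <- Series_scal_l.
  apply Series_ext. intros n. unfold shift_seq. simpl.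
  assert (INR beta ^ (n + 1) <> 0) by (apply pow_nonzero; lra). field. lra.
Qed.

Lemma val_prefix (beta : nat) (u : nat -> nat) (n : nat) :
  (1 < beta)%nat -> (forall n, (u n < beta)%nat) ->
  val beta u = (INR (prefix_int beta u n) + val beta (shift_seq n u)) / INR beta ^ n.
Proof.
intros Hb Hu. assert (Hb' : 1 < INR beta) by (apply (lt_INR 1); auto).
induction n as [|n IH].
- simpl. change (shift_seq 0 u) with u. field.
- rewrite IH. rewrite (val_step beta (shift_seq n u)); auto.
  2: { intros i; apply Hu. }
  rewrite (val_ext beta (shift_seq 1 (shift_seq n u)) (shift_seq (S n) u)).
  2: { intros i. unfold shift_seq. f_equal. lia. }
  rewrite shift_seq_0.
  simpl prefix_int. rewrite plus_INR, mult_INR. simpl pow.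
  assert (INR beta ^ n <> 0) by (apply pow_nonzero; lra). field. lra.
Qed.

Lemma prefix_int_ext (beta : nat) (u v : nat -> nat) (n : nat) :
  (forall i, (i < n)%nat -> u i = v i) -> prefix_int beta u n = prefix_int beta v n.
Proof.
induction n as [|n IH]; intros H; simpl; auto.
rewrite IH by auto. rewrite H by lia. reflexivity.
Qed.

(** The common prefix cancels in [val_prefix], and the two tails lie in [0, 1]. *)
Lemma val_close (beta : nat) (u v : nat -> nat) (n : nat) :
  (1 < beta)%nat -> (forall n, (u n < beta)%nat) -> (forall n, (v n < beta)%nat) ->
  (forall i, (i < n)%nat -> u i = v i) ->
  Rabs (val beta u - val beta v) <= / INR beta ^ n.
Proof.
intros Hb Hu Hv H. assert (Hb' : 1 < INR beta) by (apply (lt_INR 1); auto).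
rewrite (val_prefix beta u n), (val_prefix beta v n) by auto.
rewrite (prefix_int_ext beta u v n) by auto.
assert (Hp : 0 < INR beta ^ n) by (apply pow_lt; lra).
pose proof (val_bounds beta (shift_seq n u) Hb (fun i => Hu _)).
pose proof (val_bounds beta (shift_seq n v) Hb (fun i => Hv _)).
replace (_ - _) with
  ((val beta (shift_seq n u) - val beta (shift_seq n v)) / INR beta ^ n)
  by (field; lra).
unfold Rdiv. rewrite Rabs_mult, (Rabs_pos_eq (/ _))
  by (left; apply Rinv_0_lt_compat; auto).
rewrite <- (Rmult_1_l (/ INR beta ^ n)) at 2.
apply Rmult_le_compat_r; [left; apply Rinv_0_lt_compat; auto|].
apply Rabs_le. lra.
Qed.

(** Removing one period reproduces [u], so [val_prefix] becomes a linear equation for the value. *)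
Lemma val_periodic (beta : nat) (u : nat -> nat) (P : nat) :
  (1 < beta)%nat -> (0 < P)%nat -> (forall n, (u n < beta)%nat) ->
  (forall n, u (P + n)%nat = u n) ->
  val beta u = INR (prefix_int beta u P) / (INR beta ^ P - 1).
Proof.
intros Hb HP Hu Hper. assert (Hb' : 1 < INR beta) by (apply (lt_INR 1); auto).
assert (Hp : 1 < INR beta ^ P) by (apply Rlt_pow_R1; auto).
pose proof (val_prefix beta u P Hb Hu) as H.
rewrite (val_ext beta (shift_seq P u) u) in H by (intros n; apply Hper).
apply (Rmult_eq_reg_r (INR beta ^ P - 1)); [|lra].
unfold Rdiv. rewrite Rmult_assoc, Rinv_l, Rmult_1_r by lra.
rewrite Rmult_minus_distr_l. rewrite H at 1. field. lra.
Qed.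

(** The bound 0 or 1 is attained only if the first digit is 0 or [beta - 1] respectively and the
    tail attains the same bound; this propagates to all digits. *)
Lemma val_extreme (beta : nat) (u : nat -> nat) :
  (1 < beta)%nat -> (forall n, (u n < beta)%nat) ->
  val beta u = 0 \/ val beta u = 1 -> forall n, u n = u 0%nat.
Proof.
intros Hb Hu Hval. assert (Hb' : 1 < INR beta) by (apply (lt_INR 1); auto).
assert (Hone : forall w, (forall n, (w n < beta)%nat) ->
  (val beta w = 0 -> w 0%nat = 0%nat /\ val beta (shift_seq 1 w) = 0) /\
  (val beta w = 1 -> w 0%nat = (beta - 1)%nat /\ val beta (shift_seq 1 w) = 1)).
{ intros w Hw. pose proof (val_bounds beta (shift_seq 1 w) Hb (fun i => Hw _)) as Hbd.
  pose proof (val_step beta w Hb Hw) as Hst.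
  pose proof (pos_INR (w 0%nat)) as Hpos.
  pose proof (Hw 0%nat) as Hlt. apply le_INR in Hlt. rewrite S_INR in Hlt.
  assert (Hm : INR beta * val beta w = INR (w 0%nat) + val beta (shift_seq 1 w)).
  { rewrite Hst. field. lra. }
  split; intros E; rewrite E in Hm.
  - split; [|lra]. apply INR_eq. simpl. lra.
  - split; [|lra]. apply INR_eq. rewrite minus_INR by lia. simpl. lra. }
assert (Hall : forall n,
  (val beta u = 0 -> val beta (shift_seq n u) = 0) /\
  (val beta u = 1 -> val beta (shift_seq n u) = 1)).
{ induction n as [|n [IH0 IH1]].
  - change (shift_seq 0 u) with u. auto.
  - rewrite (val_ext beta (shift_seq (S n) u) (shift_seq 1 (shift_seq n u)))
      by (intros i; unfold shift_seq; f_equal; lia).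
    destruct (Hone (shift_seq n u) (fun i => Hu _)) as [H0 H1].
    split; intros E; [apply H0|apply H1]; auto. }
intros n.
destruct (Hone u Hu) as [H0 H1].
destruct (Hone (shift_seq n u) (fun i => Hu _)) as [G0 G1].
destruct (Hall n) as [A0 A1].
rewrite shift_seq_0 in G0, G1.
destruct Hval as [E|E].
- destruct (G0 (A0 E)), (H0 E). congruence.
- destruct (G1 (A1 E)), (H1 E). congruence.
Qed.

(** Where the digits first differ they are at least 1 apart, while the tails lie in [0, 1]; so the
    tail of [v] has value 0 or 1 and is constant. *)
Lemma val_eq (beta : nat) (u v : nat -> nat) :
  (1 < beta)%nat -> (forall n, (u n < beta)%nat) -> (forall n, (v n < beta)%nat) ->
  val beta u = val beta v ->
  (forall n, u n = v n) \/ exists n0, forall n, v (n0 + n)%nat = v n0.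
Proof.
intros Hb Hu Hv E. assert (Hb' : 1 < INR beta) by (apply (lt_INR 1); auto).
destruct (classic (exists n0, forall n, v (n0 + n)%nat = v n0)) as [|Hnc]; [auto|].
left.
assert (Hall : forall n, val beta (shift_seq n u) = val beta (shift_seq n v)
   -> u n = v n /\ val beta (shift_seq (S n) u) = val beta (shift_seq (S n) v)).
{ intros n En.
  pose proof (val_step beta (shift_seq n u) Hb (fun i => Hu _)) as Su.
  pose proof (val_step beta (shift_seq n v) Hb (fun i => Hv _)) as Sv.
  assert (Sh : forall w, val beta (shift_seq 1 (shift_seq n w)) = val beta (shift_seq (S n) w)).
  { intros w. apply val_ext. intros i; unfold shift_seq; f_equal; lia. }
  rewrite Sh in Su, Sv.
  rewrite shift_seq_0 in Su, Sv.
  assert (Es : INR (u n) + val beta (shift_seq (S n) u)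
             = INR (v n) + val beta (shift_seq (S n) v)).
  { apply (Rmult_eq_reg_r (/ INR beta)); [|apply Rinv_neq_0_compat; lra].
    unfold Rdiv in Su, Sv. congruence. }
  pose proof (val_bounds beta (shift_seq (S n) u) Hb (fun i => Hu _)).
  pose proof (val_bounds beta (shift_seq (S n) v) Hb (fun i => Hv _)).
  destruct (Nat.eq_dec (u n) (v n)) as [Euv|Nuv].
  - split; auto. rewrite Euv in Es. lra.
  - exfalso. apply Hnc. exists (S n). intros i.
    assert (Hext : val beta (shift_seq (S n) v) = 0 \/ val beta (shift_seq (S n) v) = 1).
    { assert (Hc : (S (u n) <= v n \/ S (v n) <= u n)%nat) by lia.
      destruct Hc as [Hc|Hc]; apply le_INR in Hc; rewrite S_INR in Hc; [left|right]; lra. }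
    pose proof (val_extreme beta (shift_seq (S n) v) Hb (fun i => Hv _) Hext i) as X.
    rewrite shift_seq_0 in X. exact X. }
assert (Hv' : forall n, val beta (shift_seq n u) = val beta (shift_seq n v)).
{ induction n as [|n IH]; [exact E|]. apply Hall; auto. }
intros n. apply Hall; auto.
Qed.

(** * Lower bounds for rational approximation and the irrationality exponent *)

Lemma IZR_abs_ge_1 (q : Z) : q <> 0%Z -> 1 <= Rabs (IZR q).
Proof. intros Hq. rewrite <- abs_IZR. apply IZR_le. lia. Qed.

(** A rational number would be at distance 0 from some fraction. For [mu > E + 1] a solution has
    [c < |q|^(E - mu) <= 1 / |q|], which bounds [q] and then [p], so only finitely many pairs
    remain. *)
Lemma irr_exponent_finite_of_lower_bound (xi c : R) (E : nat) :
  0 < c ->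
  (forall p q : Z, q <> 0%Z -> c <= Rabs (xi - IZR p / IZR q) * Rabs (IZR q) ^ E) ->
  irr_exponent_finite xi.
Proof.
intros Hc Hlow. split.
- intros (p & q & Hq & Hx). specialize (Hlow p q Hq).
  replace (xi - IZR p / IZR q) with 0 in Hlow by (rewrite Hx; ring).
  rewrite Rabs_R0, Rmult_0_l in Hlow. lra.
- exists (INR E + 1). intros mu Hinf. apply Rnot_lt_le. intros Hmu.
  assert (HE : 0 <= INR E) by apply pos_INR.
  (* [Y] will bound [|q|] and [X] will bound [|p|]; [range z] lists the integers from [-z] to
     [z]. *)
  set (Y := up (/ c)).
  set (X := up ((Rabs xi + 1) * IZR Y)).
  set (range := fun z : Z => map (fun n => (Z.of_nat n - z)%Z) (seq 0 (Z.to_nat (2 * z + 1)))).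
  assert (Hrange : forall z a, (Z.abs a <= z)%Z -> In a (range z)).
  { intros z a Ha. unfold range. apply in_map_iff. exists (Z.to_nat (a + z)).
    split; [lia|]. apply in_seq. lia. }
  destruct (Hinf (list_prod (range X) (range Y))) as (p & q & (Hp & Hq & Happ) & Hnot).
  apply Hnot. specialize (Hlow p q Hq).
  pose proof (IZR_abs_ge_1 q Hq) as Hq1.
  set (r := Rabs (IZR q)) in *.
  assert (Hrc : r < / c).
  { assert (H1 : c < Rpower r (- mu) * r ^ E).
    { eapply Rle_lt_trans; [exact Hlow|]. apply Rmult_lt_compat_r; auto.
      apply pow_lt; lra. }
    rewrite <- Rpower_pow, <- Rpower_plus in H1 by lra.
    assert (H2 : Rpower r (- mu + INR E) <= / r).
    { replace (/ r) with (Rpower r (- (1))).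
      - apply Rle_Rpower; lra.
      - rewrite Rpower_Ropp, Rpower_1; lra. }
    rewrite <- (Rinv_inv r). apply Rinv_lt_contravar; [|lra].
    apply Rmult_lt_0_compat; auto. apply Rinv_0_lt_compat; lra. }
  pose proof (archimed (/ c)) as [HY _]. fold Y in HY.
  pose proof (archimed ((Rabs xi + 1) * IZR Y)) as [HX _]. fold X in HX.
  assert (HpX : Rabs (IZR p) < IZR X).
  { assert (H1 : Rpower r (- mu) <= 1).
    { rewrite <- (Rpower_O r) by lra. apply Rle_Rpower; lra. }
    assert (H2 : Rabs (IZR p / IZR q) <= Rabs xi + 1).
    { replace (IZR p / IZR q) with (xi - (xi - IZR p / IZR q)) by ring.
      eapply Rle_trans; [apply Rabs_triang|]. rewrite Rabs_Ropp. lra. }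
    replace (IZR p) with (IZR p / IZR q * IZR q) by (field; apply not_0_IZR; auto).
    rewrite Rabs_mult. fold r. pose proof (Rabs_pos xi).
    eapply Rle_lt_trans; [|exact HX].
    apply Rmult_le_compat; try apply Rabs_pos; auto; lra. }
  apply in_prod; apply Hrange.
  + rewrite <- abs_IZR in HpX. apply lt_IZR in HpX. lia.
  + unfold r in Hrc. rewrite <- abs_IZR in Hrc.
    assert (IZR (Z.abs q) < IZR Y) by lra. apply lt_IZR in H. lia.
Qed.

(** If the least such [m] is positive, [B (m - 1) <= x] gives [B m <= x^K]; the factor [B 0] covers
    [m = 0]. *)
Lemma first_scale_above (B : nat -> R) (K : nat) (x : R) :
  1 < B 0%nat -> (2 <= K)%nat -> (forall m, B (S m) = B m ^ K) -> 1 <= x ->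
  exists m, x < B m <= B 0%nat * x ^ K.
Proof.
intros HB0 HK HB Hx.
assert (HxK : 1 <= x ^ K) by (apply pow_R1_Rle; auto).
assert (Hgrow : forall m, B 0%nat ^ S m <= B m).
{ induction m as [|m IH]; [simpl; lra|].
  rewrite HB. apply Rle_trans with ((B 0%nat ^ S m) ^ 2).
  - rewrite <- pow_mult. apply Rle_pow; [lra|lia].
  - apply Rle_trans with (B m ^ 2).
    + apply pow_incr. split; auto. apply pow_le; lra.
    + apply Rle_pow; auto.
      apply Rle_trans with (B 0%nat ^ S m); auto. apply pow_R1_Rle; lra. }
assert (Hex : exists m, x < B m).
{ destruct (Pow_x_infinity (B 0%nat)) with (b := x + 1) as [n Hn].
  { rewrite Rabs_pos_eq; lra. }
  exists n. specialize (Hn (S n) ltac:(lia)). specialize (Hgrow n).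
  rewrite Rabs_pos_eq in Hn by (apply pow_le; lra). lra. }
destruct Hex as [m Hm]. induction m as [|m IH].
- exists 0%nat. split; auto. rewrite <- (Rmult_1_r (B 0%nat)) at 1.
  apply Rmult_le_compat_l; lra.
- destruct (Rlt_le_dec x (B m)) as [H|H]; [auto|].
  exists (S m). split; auto. rewrite HB.
  apply Rle_trans with (x ^ K).
  + apply pow_incr. split; auto.
    apply Rle_trans with (B 0%nat ^ S m); auto. apply pow_le; lra.
  + rewrite <- (Rmult_1_l (x ^ K)) at 1. apply Rmult_le_compat_r; lra.
Qed.

(* At the scale [m] where [B m] first exceeds [2 |q|], a fraction [p / q] differs
   from one of the two approximants of index [m] and [m + h], hence is at
   distance at least [1 / (q Q)] from it. *)
Lemma irr_exponent_finite_of_approximants (xi : R) (B : nat -> R)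
  (P Q : nat -> Z) (K D h : nat) :
  1 < B 0%nat -> (2 <= K)%nat -> (forall m, B (S m) = B m ^ K) ->
  (forall m, (0 < Q m)%Z) ->
  (forall m, IZR (Q m) <= B m ^ D) ->
  (forall m, Rabs (xi - IZR (P m) / IZR (Q m)) <= / (IZR (Q m) * B m)) ->
  (forall m, IZR (P m) / IZR (Q m) <> IZR (P (m + h)%nat) / IZR (Q (m + h)%nat)) ->
  irr_exponent_finite xi.
Proof.
intros HB0 HK HB HQ HQB Happ Hne.
assert (HBS : forall m, B m <= B (S m) /\ 1 < B m).
{ induction m as [|m [IH1 IH2]].
  - split; auto. rewrite HB. rewrite <- (pow_1 (B 0%nat)) at 1. apply Rle_pow; [lra|lia].
  - assert (1 < B (S m)) by lra. split; auto.
    rewrite (HB (S m)). rewrite <- (pow_1 (B (S m))) at 1. apply Rle_pow; [lra|lia]. }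
assert (HBh : forall m h', B (m + h')%nat = B m ^ (K ^ h')).
{ intros m h'. induction h' as [|h' IH].
  - rewrite Nat.add_0_r. simpl. ring.
  - rewrite Nat.add_succ_r, HB, IH, <- pow_mult. f_equal. simpl. ring. }
(* [B (m + h) ^ D = B m ^ F] bounds both candidate denominators at scale [m]. *)
set (F := (K ^ h * D)%nat).
(* [c] comes from the distance [1 / (2 r Q)] with [Q <= (B 0 * (2 r)^K)^F]. *)
set (c := / (2 * (B 0%nat * 2 ^ K) ^ F)).
assert (Hc0 : 0 < (B 0%nat * 2 ^ K) ^ F).
{ apply pow_lt. apply Rmult_lt_0_compat; [lra|]. apply pow_lt; lra. }
apply irr_exponent_finite_of_lower_bound with (c := c) (E := (S (K * F))).
{ unfold c. apply Rinv_0_lt_compat. lra. }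
intros p q Hq. pose proof (IZR_abs_ge_1 q Hq) as Hr.
set (r := Rabs (IZR q)) in *.
(* Exceeding [2 r] rather than [r] makes the error at most half of the separation [1 / (r Q)]. *)
destruct (first_scale_above B K (2 * r) HB0 HK HB ltac:(lra)) as (m & Hm1 & Hm2).
assert (Hmono : B m <= B (m + h)%nat).
{ generalize h as h'. induction h' as [|h' IH]; [rewrite Nat.add_0_r; lra|].
  rewrite Nat.add_succ_r. destruct (HBS (m + h')%nat). lra. }
assert (Hsel : exists m', B m <= B m' <= B (m + h)%nat /\
                IZR (P m') / IZR (Q m') <> IZR p / IZR q).
{ destruct (Req_dec (IZR (P m) / IZR (Q m)) (IZR p / IZR q)) as [E|E].
  - exists (m + h)%nat. split; [lra|]. intros E'. apply (Hne m). congruence.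
  - exists m. split; [lra|]. exact E. }
destruct Hsel as (m' & [Hm'1 Hm'2] & Hneq).
assert (HQ1 : 1 <= IZR (Q m')) by (apply IZR_le; specialize (HQ m'); lia).
assert (Hq0 : IZR q <> 0) by (apply not_0_IZR; auto).
(* The cross difference of two distinct fractions is a nonzero integer. *)
assert (Hsep : / (r * IZR (Q m')) <= Rabs (IZR (P m') / IZR (Q m') - IZR p / IZR q)).
{ replace (IZR (P m') / IZR (Q m') - IZR p / IZR q)
    with (IZR (P m' * q - p * Q m') / (IZR q * IZR (Q m')))
    by (rewrite minus_IZR, !mult_IZR; field; split; lra).
  unfold Rdiv. rewrite Rabs_mult, Rabs_inv, Rabs_mult. fold r.
  rewrite (Rabs_pos_eq (IZR (Q m'))) by lra.
  rewrite <- (Rmult_1_l (/ (r * IZR (Q m')))) at 1.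
  apply Rmult_le_compat_r.
  - left. apply Rinv_0_lt_compat. apply Rmult_lt_0_compat; lra.
  - apply IZR_abs_ge_1. intros H0. apply Hneq.
    assert (HI : IZR (P m') * IZR q = IZR p * IZR (Q m')).
    { rewrite <- !mult_IZR. f_equal. lia. }
    apply (Rmult_eq_reg_r (IZR q * IZR (Q m'))).
    + transitivity (IZR (P m') * IZR q); [field; lra|].
      rewrite HI. field. auto.
    + apply Rmult_integral_contrapositive; lra. }
assert (Hmain : / (2 * (r * IZR (Q m'))) <= Rabs (xi - IZR p / IZR q)).
{ specialize (Happ m').
  assert (Hsmall : / (IZR (Q m') * B m') <= / (2 * (r * IZR (Q m')))).
  { apply Rinv_le_contravar.
    - apply Rmult_lt_0_compat; [lra|]. apply Rmult_lt_0_compat; lra.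
    - replace (2 * (r * IZR (Q m'))) with (IZR (Q m') * (2 * r)) by ring.
      apply Rmult_le_compat_l; lra. }
  pose proof (Rabs_triang (IZR (P m') / IZR (Q m') - xi) (xi - IZR p / IZR q)) as Ht.
  replace (IZR (P m') / IZR (Q m') - xi + (xi - IZR p / IZR q))
    with (IZR (P m') / IZR (Q m') - IZR p / IZR q) in Ht by ring.
  rewrite (Rabs_minus_sym _ xi) in Ht.
  replace (/ (r * IZR (Q m'))) with (2 * / (2 * (r * IZR (Q m')))) in Hsep
    by (field; lra).
  lra. }
assert (HQF : IZR (Q m') <= (B 0%nat * 2 ^ K) ^ F * r ^ (K * F)).
{ eapply Rle_trans; [apply HQB|].
  apply Rle_trans with (B (m + h)%nat ^ D).
  { apply pow_incr. destruct (HBS m'). lra. }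
  rewrite HBh, <- pow_mult. fold F.
  rewrite (pow_mult r K F), <- Rpow_mult_distr.
  apply pow_incr. destruct (HBS m). split; [lra|].
  rewrite Rmult_assoc, <- Rpow_mult_distr. exact Hm2. }
assert (HrE : 0 < r ^ (K * F)) by (apply pow_lt; lra).
apply Rle_trans with (/ (2 * (r * IZR (Q m'))) * r ^ S (K * F)).
- unfold c. simpl.
  apply Rle_trans with (/ (2 * (r * ((B 0%nat * 2 ^ K) ^ F * r ^ (K * F)))) * (r * r ^ (K * F))).
  + right. field. lra.
  + apply Rmult_le_compat_r; [apply Rmult_le_pos; lra|].
    apply Rinv_le_contravar; [repeat apply Rmult_lt_0_compat; lra|].
    repeat apply Rmult_le_compat_l; lra.
- apply Rmult_le_compat_r; [apply pow_le; lra|]. exact Hmain.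
Qed.

(** * From repetitions in a word to rational approximants *)

(* The approximants are the values of the purely periodic words of period
   [D * M m] that share a prefix of length [(D + 1) * M m] with [u]. *)
Lemma irr_exponent_finite_of_prefix_repetitions (beta : nat) (u M : nat -> nat)
  (K D h : nat) :
  (1 < beta)%nat -> (forall n, (u n < beta)%nat) ->
  (2 <= K)%nat -> (0 < D)%nat ->
  (0 < M 0)%nat -> (forall m, M (S m) = M m * K)%nat ->
  (forall m n, (n < M m)%nat -> u (n + D * M m)%nat = u n) ->
  (forall m, exists n, (n + D * M m < D * M (m + h))%nat /\ u (n + D * M m)%nat <> u n) ->
  irr_exponent_finite (val beta u).
Proof.
intros Hb Hu HK HD HM0 HM Hrep Hdiff.
assert (Hb' : 1 < INR beta) by (apply (lt_INR 1); auto).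
assert (HMpos : forall m, (0 < M m)%nat).
{ induction m as [|m IH]; auto. rewrite HM. nia. }
assert (HDM : forall m, (0 < D * M m)%nat) by (intros m; specialize (HMpos m); nia).
set (v := fun m n => u (n mod (D * M m))%nat).
assert (Hv : forall m n, (v m n < beta)%nat) by (intros m n; apply Hu).
assert (Hvper : forall m n, v m (D * M m + n)%nat = v m n).
{ intros m n. unfold v. f_equal.
  replace (D * M m + n)%nat with (n + 1 * (D * M m))%nat by ring.
  apply Nat.Div0.mod_add. }
assert (Hvu : forall m n, (n < D * M m)%nat -> v m n = u n).
{ intros m n Hn. unfold v. rewrite Nat.mod_small; auto. }
(* Past the first period, [Hrep] supplies [M m] further letters of agreement. *)
assert (Hvu' : forall m n, (n < D * M m + M m)%nat -> u n = v m n).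
{ intros m n Hn. destruct (Nat.lt_ge_cases n (D * M m)) as [H|H].
  - symmetry; auto.
  - replace n with (D * M m + (n - D * M m))%nat at 2 by lia.
    assert (M m <= D * M m)%nat by nia.
    rewrite Hvper, Hvu by lia.
    rewrite <- (Hrep m (n - D * M m)%nat) by lia. f_equal. lia. }
set (Q := fun m => (Z.of_nat (beta ^ (D * M m)) - 1)%Z).
assert (HQ : forall m, IZR (Q m) = INR beta ^ (D * M m) - 1).
{ intros m. unfold Q. rewrite minus_IZR, <- INR_IZR_INZ, pow_INR. reflexivity. }
set (P := fun m => Z.of_nat (prefix_int beta (v m) (D * M m))).
assert (HPQ : forall m, IZR (P m) / IZR (Q m) = val beta (v m)).
{ intros m. unfold P. rewrite HQ, <- INR_IZR_INZ. symmetry.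
  apply val_periodic; auto. }
apply irr_exponent_finite_of_approximants with
  (B := fun m => INR beta ^ M m) (P := P) (Q := Q) (K := K) (D := D) (h := h); auto.
- apply Rlt_pow_R1; auto.
- intros m. rewrite HM, pow_mult. reflexivity.
- intros m. apply lt_IZR. rewrite HQ.
  assert (1 < INR beta ^ (D * M m)) by (apply Rlt_pow_R1; auto). lra.
- intros m. rewrite HQ, <- pow_mult, (Nat.mul_comm (M m)). lra.
- intros m. rewrite HPQ.
  eapply Rle_trans; [apply (val_close beta u (v m) (D * M m + M m)); auto|].
  rewrite HQ, pow_add.
  assert (1 < INR beta ^ (D * M m)) by (apply Rlt_pow_R1; auto).
  assert (1 < INR beta ^ M m) by (apply Rlt_pow_R1; auto).
  apply Rinv_le_contravar; [apply Rmult_lt_0_compat; lra|].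
  apply Rmult_le_compat_r; lra.
- intros m. rewrite !HPQ. intros E.
  destruct (Hdiff m) as (n & Hn & Hne). apply Hne.
  (* Either the two words agree, or [v (m + h)] is eventually constant and, being periodic,
     constant; both contradict [Hne]. *)
  destruct (val_eq beta (v m) (v (m + h)%nat) Hb (Hv m) (Hv _) E) as [Heq|[n0 Hc]].
  + rewrite <- (Hvu (m + h)%nat), <- (Hvu (m + h)%nat n) by lia.
    rewrite <- !Heq, <- (Hvper m n). f_equal. lia.
  + assert (Hall : forall i, v (m + h)%nat i = v (m + h)%nat n0).
    (* The shift is chosen so that the position becomes [i] plus [n0] full periods. *)
    { intros i. rewrite <- (Hc (n0 * (D * M (m + h)) - n0 + i)%nat).
      specialize (HDM (m + h)%nat).
      replace (n0 + (n0 * (D * M (m + h)) - n0 + i))%nat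
        with (i + n0 * (D * M (m + h)))%nat by nia.
      unfold v. rewrite Nat.Div0.mod_add. reflexivity. }
    rewrite <- (Hvu (m + h)%nat), <- (Hvu (m + h)%nat n) by lia.
    rewrite (Hall (n + _)%nat), (Hall n). reflexivity.
Qed.

(** * Repetitions along the arithmetic progression and the conclusion *)

Lemma digit_sum_progression_repetitions (L k : nat) (kappa : nat -> nat -> nat)
  (N0 t N l : nat) :
  (0 < L)%nat -> (2 <= k)%nat -> (0 < t)%nat -> (0 < l)%nat ->
  (forall s n, (1 <= s <= k - 1)%nat -> (N0 <= n)%nat ->
     kappa s n = kappa s (n + t)%nat) ->
  ~ (exists A : nat, forall s y, (1 <= s <= k - 1)%nat ->
        (kappa s (A + y) mod L = (kappa 1%nat A * s * k ^ y) mod L)%nat) ->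
  let M m := (k ^ (N0 + t * (m + (N + l))))%nat in
  let G n := digit_sum k kappa 0 (N + n * l) in
  exists D h, (0 < D)%nat /\
    (forall m n, (n < M m)%nat -> congr L (G (n + D * M m)%nat) (G n)) /\
    (forall m, exists n, (n + D * M m < D * M (m + h)%nat)%nat /\
       ~ congr L (G (n + D * M m)%nat) (G n)).
Proof.
intros HL Hk Ht Hl Hper Hexc M G.
destruct (digit_sum_return L k kappa N0 t l HL Hk Ht Hper) as (D & HD & Hret).
(* The summand [N + l] in the exponent of [M] secures this already at [m = 0]. *)
assert (HMl : forall m, (N + l < M m)%nat).
{ intros m. unfold M. pose proof (Nat.pow_gt_lin_r k (N0 + t * (m + (N + l))) Hk). nia. }
assert (Hsplit : forall m c r, (r < M m)%nat ->
  digit_sum k kappa 0 (c * M m + r)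
  = (digit_sum k kappa 0 r + digit_sum k kappa N0 c)%nat).
{ intros m c r Hr. unfold M in *. rewrite digit_sum_split by auto.
  rewrite Nat.add_0_l, (digit_sum_period k kappa N0 t) by auto. reflexivity. }
(* Adding [D * M m] to [n] only replaces [c] by [c + D * l], so whether a letter repeats depends on
   [c] alone. *)
assert (HG : forall m c r n, (r < M m)%nat -> (N + n * l = c * M m + r)%nat ->
  congr L (G (n + D * M m)%nat) (G n) <->
  congr L (digit_sum k kappa N0 (c + D * l)) (digit_sum k kappa N0 c)).
{ intros m c r n Hr Hn. unfold G.
  replace (N + (n + D * M m) * l)%nat with ((c + D * l) * M m + r)%nat by nia.
  rewrite Hn, !Hsplit by auto. unfold congr.
  replace (Z.of_nat (digit_sum k kappa 0 r + digit_sum k kappa N0 (c + D * l))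
           - Z.of_nat (digit_sum k kappa 0 r + digit_sum k kappa N0 c))%Z
    with (Z.of_nat (digit_sum k kappa N0 (c + D * l))
          - Z.of_nat (digit_sum k kappa N0 c))%Z by lia.
  reflexivity. }
(* Without such a [c], the digit sum at level [N0] has period [D * l] mod [L], so the one at level
   [N0 + D * l] is linear; its values at [s * k^y] give the excluded congruence. *)
assert (Hv : exists c, ~ congr L (digit_sum k kappa N0 (c + D * l)) (digit_sum k kappa N0 c)).
{ apply NNPP. intros Hno. apply Hexc.
  assert (HDl : (0 < D * l)%nat) by nia.
  assert (Hall : forall c,
    congr L (digit_sum k kappa N0 c) (digit_sum k kappa N0 (c + D * l))).
  { intros c. destruct (classic (congr L (digit_sum k kappa N0 (c + D * l))
                                         (digit_sum k kappa N0 c))) as [[z Hz]|H].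
    - exists (- z)%Z. lia.
    - exfalso; eauto. }
  pose proof (digit_sum_periodic_linear L k kappa N0 (D * l) Hk HDl Hall) as Hlin.
  exists (N0 + D * l)%nat. intros s y Hs.
  apply congr_mod_eq; auto.
  specialize (Hlin (s * k ^ y)%nat).
  rewrite (digit_sum_small k kappa (N0 + D * l) 1) in Hlin by lia.
  assert (Hky : (0 < k ^ y)%nat) by (pose proof (Nat.pow_nonzero k y); lia).
  replace (s * k ^ y)%nat with (s * k ^ y + 0)%nat in Hlin at 1 by lia.
  rewrite digit_sum_split, digit_sum_0, digit_sum_small in Hlin by lia.
  unfold digit_weight in Hlin. simpl in Hlin.
  destruct (Nat.eqb_spec s 0) as [H0|_]; [lia|].
  replace (kappa 1 (N0 + D * l) * s * k ^ y)%nat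
    with (s * k ^ y * kappa 1 (N0 + D * l))%nat by ring.
  exact Hlin. }
destruct Hv as [c Hc].
(* This [h] gives [M (m + h) >= (c + D + 2) * M m], which leaves room for [n + D * M m]. *)
exists D, (c + 1 + D)%nat. split; [exact HD|split].
- intros m n Hn. specialize (HMl m).
  pose proof (Nat.div_mod_eq (N + n * l) (M m)) as Hdm.
  pose proof (Nat.mod_upper_bound (N + n * l) (M m) ltac:(lia)) as Hr.
  apply (HG m ((N + n * l) / M m)%nat _ n Hr); [lia|]. apply Hret.
  (* [n < M m] and [N < M m] give [N + n * l < (l + 1) * M m]. *)
  assert (Hlt : ((N + n * l) / M m < l + 1)%nat)
    by (apply Nat.Div0.div_lt_upper_bound; nia).
  lia.
(* [n * l] is the first multiple of [l] above [c * M m], so [N + n * l] exceeds [c * M m] by at most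
   [N + l < M m]. *)
- intros m. exists (c * M m / l + 1)%nat. specialize (HMl m).
  pose proof (Nat.div_mod_eq (c * M m) l) as Hdm.
  pose proof (Nat.mod_upper_bound (c * M m) l ltac:(lia)) as Hr.
  split.
  + assert (HMh : (M (m + (c + 1 + D)) >= M m * (c + 1 + D + 1))%nat).
    { unfold M.
      replace (N0 + t * (m + (c + 1 + D) + (N + l)))%nat
        with (N0 + t * (m + (N + l)) + t * (c + 1 + D))%nat by ring.
      rewrite Nat.pow_add_r. apply Nat.mul_le_mono_l.
      pose proof (Nat.pow_gt_lin_r k (t * (c + 1 + D)) Hk). nia. }
    assert (Hq : (c * M m / l <= c * M m)%nat) by (apply Nat.Div0.div_le_upper_bound; nia).
    nia.
  + rewrite (HG m c (N + l - (c * M m) mod l)%nat); [exact Hc|lia|].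
    rewrite Nat.mul_add_distr_r, (Nat.mul_comm _ l). lia.
Qed.

Theorem theorem5p3 (L k : nat) (kappa : nat -> nat -> nat) (av : nat -> C)
  (beta : nat) (N l : nat) :
  (2 <= L)%nat -> (2 <= k)%nat ->
  (forall s n, (1 <= s <= k - 1)%nat -> (kappa s n < L)%nat) ->
  (forall i j, (i < L)%nat -> (j < L)%nat -> av i = av j -> i = j) ->
  (1 < beta)%nat ->
  (forall n, exists d : nat, (d < beta)%nat /\ TM_seq L k kappa av n = RtoC (INR d)) ->
  n_period k kappa ->
  (0 < l)%nat ->
  ~ (exists A : nat, forall s y, (1 <= s <= k - 1)%nat ->
        (kappa s (A + y) mod L = (kappa 1%nat A * s * k ^ y) mod L)%nat) ->
  irr_exponent_finite
    (Series (fun n => Re (TM_seq L k kappa av (N + n * l)%nat) / INR beta ^ (n + 1))).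
Proof.
intros HL Hk _ Hinj Hb Hdig (N0 & t & Ht & Hper) Hl Hexc.
destruct (functional_choice _ Hdig) as [e He].
set (u := fun n => e (N + n * l)%nat).
replace (Series _) with (val beta u).
2: { apply Series_ext. intros n. destruct (He (N + n * l)%nat) as [_ ->]. reflexivity. }
destruct (digit_sum_progression_repetitions L k kappa N0 t N l)
  as (D & h & HD & Hrep & Hdiff); auto; [lia|].
set (G := fun n => digit_sum k kappa 0 (N + n * l)) in *.
set (M := fun m => (k ^ (N0 + t * (m + (N + l))))%nat) in *.
(* Equal digits mean congruent digit sums, since [av] is injective on indices below [L]. *)
assert (Hu : forall n n', u n = u n' <-> congr L (G n) (G n')).
{ intros n n'. rewrite congr_mod_eq by lia.
  destruct (He (N + n * l)%nat) as [_ E], (He (N + n' * l)%nat) as [_ E'].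
  unfold TM_seq in E, E'. rewrite TM_index_digit_sum in E, E' by lia.
  fold (G n) (u n) in E. fold (G n') (u n') in E'.
  split; intros H.
  - apply Hinj; [apply Nat.mod_upper_bound; lia..|]. congruence.
  - apply INR_eq. rewrite H in E. rewrite E in E'.
    injection E'. auto. }
apply irr_exponent_finite_of_prefix_repetitions
  with (M := M) (K := (k ^ t)%nat) (D := D) (h := h);
  [exact Hb|intros n; apply He| | exact HD| | | |].
- pose proof (Nat.pow_gt_lin_r k t Hk). lia.
- unfold M. pose proof (Nat.pow_nonzero k (N0 + t * (0 + (N + l)))). lia.
- intros m. unfold M. rewrite <- Nat.pow_add_r. f_equal. ring.
- intros m n Hn. apply Hu. apply Hrep. exact Hn.
- intros m. destruct (Hdiff m) as (n & Hn & Hne).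
  exists n. split; auto. rewrite Hu. exact Hne.
Qed.
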